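(* For any Hausdorff space $X$, $aL'(X)\leq L'(X)\leq L(X)$.
   Context: An open ultrafilter on a Hausdorff space $X$ is a maximal filter in the family of open subsets of $X$ (its members are nonempty open sets); it converges to $x\in X$ if it contains every open set containing $x$. $EX$ is the set of all convergent open ultrafilters on $X$. A section is a function $b:X\to EX$ such that $b(x)$ converges to $x$ for every $x\in X$. For a section $b$ and an open set $U$ let $\widehat{U}_b=\{x\in X: U\in b(x)\}$, and for $A\subseteq X$ let $c_b(A)=\{x\in X:\widehat{U}_b\cap A\neq\varnothing\text{ for every open }U\ni x\}$. $A$ is $c_b$-closed if $c_b(A)=A$. For $A\subseteq X$, $aL(A,X)$ is the least infinite cardinal $\kappa$ such that every cover $\mathcal V$ of $A$ by open sets of $X$ has a subfamily $\mathcal W$ with $|\mathcal W|\leq\kappa$ and $A\subseteq\bigcup_{W\in\mathcal W}cl\,W$. Put $aL^b(X)=\sup\{aL(C,X): C\text{ is }c_b\text{-closed}\}+\aleph_0$ and $aL'(X)=\min\{aL^b(X): b\text{ a section}\}$. Fix any section $b'$ with $aL^{b'}(X)=aL'(X)$ and write $\widehat{U}=\widehat{U}_{b'}$. $L'(X)$ is the least infinite cardinal $\kappa$ such that for every open cover $\mathcal V$ of $X$ there is $\mathcal W\subseteq\mathcal V$ with $|\mathcal W|\leq\kappa$ and $X=\bigcup_{W\in\mathcal W}\widehat{W}$. $L(X)$ is the Lindelöf degree: the least infinite cardinal $\kappa$ such that every open cover of $X$ has a subcover of size at most $\kappa$. *)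

(* Defs.v *)
From mathcomp Require Import all_boot all_order.
From mathcomp Require Import boolp classical_sets functions cardinality.
From mathcomp Require Import topology.

Set Implicit Arguments.
Unset Strict Implicit.
Unset Printing Implicit Defensive.

Local Open Scope classical_set_scope.
Local Open Scope card_scope.

(* Cardinals are represented by types: [K] stands for its cardinality, the order
   is [#<=] and equality is [#=], both between the full sets [[set: K]]. *)

Definition is_least_card (P : Type -> Prop) (K : Type) : Prop :=
  P K /\ forall K' : Type, P K' -> [set: K] #<= [set: K'].

(* The value [nat] is a dummy: by [leastP] below it is never reached when [P]
   holds of some type. *)
Definition least_card (P : Type -> Prop) : Type :=
  if pselect (exists K, is_least_card P K) is left h then sval (cid h) else nat.

Definition infinite_card (K : Type) : Prop := infinite_set [set: K].

Section open_ultrafilters.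
Context {X : topologicalType}.

Record open_filter (F : set (set X)) : Prop := OpenFilter {
  open_filter_nonempty : F !=set0;
  open_filter_open : forall U, F U -> open U;
  open_filter_mem_nonempty : forall U, F U -> U !=set0;
  open_filterI : forall U V, F U -> F V -> F (U `&` V);
  open_filterS : forall U V, F U -> open V -> U `<=` V -> F V }.

Definition open_ultrafilter (F : set (set X)) : Prop :=
  open_filter F /\ forall G, open_filter G -> F `<=` G -> G = F.

Definition open_converges (F : set (set X)) (x : X) : Prop :=
  forall U, open U -> U x -> F U.

End open_ultrafilters.

Definition EX (X : topologicalType) : Type :=
  {F : set (set X) | open_ultrafilter F /\ exists x, open_converges F x}.

Section invariants.
Context {X : topologicalType}.

Definition is_section (b : X -> EX X) : Prop :=
  forall x, open_converges (sval (b x)) x.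

Definition hat (b : X -> EX X) (U : set X) : set X := [set x | sval (b x) U].

Definition cb (b : X -> EX X) (A : set X) : set X :=
  [set x | forall U, open U -> U x -> hat b U `&` A !=set0].

Definition cb_closed (b : X -> EX X) (A : set X) : Prop := cb b A = A.

Definition open_cover (A : set X) (V : set (set X)) : Prop :=
  V `<=` open /\ A `<=` \bigcup_(U in V) U.

Definition aL (A : set X) : Type :=
  least_card (fun K => infinite_card K /\
    forall V, open_cover A V -> exists W : set (set X),
      [/\ W `<=` V, W #<= [set: K] & A `<=` \bigcup_(U in W) closure U]).

Definition sup_aL (b : X -> EX X) : Type :=
  least_card (fun K => forall C, cb_closed b C -> [set: aL C] #<= [set: K]).

Definition aLb (b : X -> EX X) : Type := (sup_aL b + nat)%type.

Definition L' (b : X -> EX X) : Type :=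
  least_card (fun K => infinite_card K /\
    forall V, open_cover [set: X] V -> exists W : set (set X),
      [/\ W `<=` V, W #<= [set: K] & [set: X] = \bigcup_(U in W) hat b U]).

End invariants.

Definition aL' (X : topologicalType) : Type :=
  least_card (fun K => exists b : X -> EX X,
    is_section b /\ [set: K] #= [set: aLb b]).

Definition L (X : topologicalType) : Type :=
  least_card (fun K => infinite_card K /\
    forall V, open_cover [set: X] V -> exists W : set (set X),
      [/\ W `<=` V, W #<= [set: K] & [set: X] `<=` \bigcup_(U in W) U]).

(* The rest of the file checks that every invariant above is well defined, and
   that a section attaining the minimum [aL'] exists. *)

Lemma inj_cardT (T U : Type) (f : T -> U) :
  injective f -> [set: T] #<= [set: U].
Proof.
move=> finj.
have [g] : $|{injfun [set: T] >-> [set: U]}|.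
  by apply/injfunPex; exists f => // x y _ _; exact: finj.
exact: inj_card_le g.
Qed.

Lemma least_family (I : Type) (T : I -> Type) (i0 : I) :
  exists i, forall j, [set: T i] #<= [set: T j].
Proof.
pose Q : set (set (forall i, T i)) :=
  [set S | forall f g i, S f -> S g -> f i = g i -> f = g].
have [S [QS Smax]] : exists A, Q A /\ forall B, A `<` B -> ~ Q B.
  apply: Zorn_bigcup => F FQ Ftot f g i [A FA Af] [B FB Bg] fg.
  have [AB|BA] := Ftot A B FA FB.
    exact: FQ FB _ _ _ (AB _ Af) Bg fg.
  exact: FQ FA _ _ _ Af (BA _ Bg) fg.
have [i surj_i] : exists i, forall t : T i, exists2 f, S f & f i = t.
  apply: contrapT => nsurj.
  have miss i : {t : T i | forall f, S f -> f i <> t}.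
    apply: cid; apply: contrapT => nmiss; apply: nsurj; exists i => t.
    apply: contrapT => nt; apply: nmiss; exists t => f Sf ft.
    by apply: nt; exists f.
  pose g i := sval (miss i).
  have gP i f : S f -> f i <> g i by move=> Sf; exact: (svalP (miss i)).
  apply: (Smax (S `|` [set g])).
    split; last by move=> SgS; exact: (gP i0 g (SgS _ (or_intror erefl)) erefl).
    by move=> f Sf; left.
  move=> f1 f2 j [Sf1|->] [Sf2|->] //=; first exact: QS.
    by move/(gP _ _ Sf1).
  by move/esym/(gP _ _ Sf2).
exists i => j.
pose f t := s2val (cid2 (surj_i t)).
have fS t : S (f t) by exact: s2valP.
have fi t : f t i = t by exact: (s2valP' (cid2 (surj_i t))).
apply: (@inj_cardT (T i) (T j) (fun t => f t j)) => t u tu.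
by rewrite -(fi t) -(fi u) (QS _ _ j (fS t) (fS u) tu).
Qed.

(* Cardinals are well ordered. *)
Lemma leastP (P : Type -> Prop) :
  (exists K, P K) -> is_least_card P (least_card P).
Proof.
move=> [K0 PK0]; rewrite /least_card; case: pselect => [h|nh]; first exact: svalP.
exfalso; apply: nh.
pose I := {A : set K0 | exists K, P K /\ [set: K] #= A}.
have i0 : I by exists setT; exists K0.
have [[A [K [PK KA]]] Amin] := least_family (fun i : I => set_type (sval i)) i0.
have {}Amin (B : set K0) K' : P K' -> [set: K'] #= B -> A #<= B.
  move=> PK' K'B; have /= := Amin (exist _ B (ex_intro _ K' (conj PK' K'B))).
  by rewrite (card_le_eql (card_setT A)) (card_le_eqr (card_setT B)).
exists K; split => // K' PK'; rewrite (card_le_eql KA).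
have [[] tot] := least_family (fun c : bool => if c then K0 else K') true.
  apply: card_le_trans (tot false).
  exact: card_leT.
have /card_leP[f] := tot true.
pose g (t : K') : K0 := val (f (to_setT t)).
have ginj : injective g.
  by move=> t u /val_inj /(@inj _ _ _ f) => /(_ (in_setT _) (in_setT _)) [].
have K'g : [set: K'] #= g @` [set: K'].
  by rewrite card_eq_sym; apply: inj_card_eq => t u _ _; exact: ginj.
by rewrite (card_le_eqr K'g); exact: Amin PK' K'g.
Qed.

Section well_defined.
Context {X : topologicalType}.
Implicit Types (b : X -> EX X) (V W : set (set X)).

Let K0 : Type := (nat + set X)%type.

Let K0_infinite : infinite_card K0.
Proof. by apply/infiniteP; apply: (@inj_cardT nat K0 inl) => x y []. Qed.

Let le_K0 V : V #<= [set: K0].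
Proof.
apply: card_le_trans (card_leT V) _.
by apply: (@inj_cardT (set X) K0 inr) => x y [].
Qed.

Lemma sub_hat b U : is_section b -> open U -> U `<=` hat b U.
Proof. by move=> sb oU x Ux; exact: sb. Qed.

Lemma aLP (A : set X) :
  is_least_card (fun K => infinite_card K /\
    forall V, open_cover A V -> exists W : set (set X),
      [/\ W `<=` V, W #<= [set: K] & A `<=` \bigcup_(U in W) closure U]) (aL A).
Proof.
apply: leastP; exists K0; split=> // V [_ AV]; exists V; split => //.
by move=> x /AV[U VU Ux]; exists U => //; exact: subset_closure.
Qed.

Lemma sup_aLP b :
  is_least_card (fun K => forall C, cb_closed b C -> [set: aL C] #<= [set: K])
    (sup_aL b).
Proof.
apply: leastP; exists K0 => C _; apply: (aLP C).2; split => // V [_ AV].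
by exists V; split => // x /AV[U VU Ux]; exists U => //; exact: subset_closure.
Qed.

Lemma LP :
  is_least_card (fun K => infinite_card K /\
    forall V, open_cover [set: X] V -> exists W : set (set X),
      [/\ W `<=` V, W #<= [set: K] & [set: X] `<=` \bigcup_(U in W) U]) (L X).
Proof. by apply: leastP; exists K0; split=> // V [_ XV]; exists V; split. Qed.

Lemma L'P b : is_section b ->
  is_least_card (fun K => infinite_card K /\
    forall V, open_cover [set: X] V -> exists W : set (set X),
      [/\ W `<=` V, W #<= [set: K] & [set: X] = \bigcup_(U in W) hat b U]) (L' b).
Proof.
move=> sb; apply: leastP; exists K0; split=> // V [oV XV]; exists V; split => //.
apply/seteqP; split => // x /XV[U VU Ux]; exists U => //.
exact: sub_hat sb (oV _ VU) _ Ux.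
Qed.

Lemma open_ultrafilter_exists (x : X) :
  exists F : set (set X), open_ultrafilter F /\ open_converges F x.
Proof.
pose N := [set U : set X | open U /\ U x].
pose Q : set (set (set X)) := [set F | F = set0 \/ open_filter F /\ N `<=` F].
have NQ : open_filter N.
  split.
  - by exists setT; split => //; exact: openT.
  - by move=> U [].
  - by move=> U [_ Ux]; exists x.
  - by move=> U V [oU Ux] [oV Vx]; split; [exact: openI|].
  - by move=> U V [oU Ux] oV UV; split => //; exact: UV.
have [F [QF Fmax]] : exists A, Q A /\ forall B, A `<` B -> ~ Q B.
  apply: Zorn_bigcup => G GQ Gtot.
  have [[A [GA A0]]|nA] := pselect (exists A, G A /\ A !=set0); last first.
    left; apply/seteqP; split => // U [A GA AU]; apply: nA; exists A; split => //.
    by exists U.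
  have H B U : G B -> B U -> open_filter B.
    by move=> GB BU; have [B0|[]//] := GQ _ GB; move: BU; rewrite B0.
  right; split.
    split.
    - by case: A0 => U AU; exists U, A.
    - by move=> U [B GB BU]; exact: open_filter_open (H _ _ GB BU) _ BU.
    - by move=> U [B GB BU]; exact: open_filter_mem_nonempty (H _ _ GB BU) _ BU.
    - move=> U V [B GB BU] [C GC CV]; have [BC|CB] := Gtot _ _ GB GC.
        by exists C => //; apply: (open_filterI (H _ _ GC CV)) => //; exact: BC.
      by exists B => //; apply: (open_filterI (H _ _ GB BU)) => //; exact: CB.
    - move=> U V [B GB BU] oV UV; exists B => //.
      exact: open_filterS (H _ _ GB BU) _ _ BU oV UV.
  move=> U NU; exists A => //.
  have [A00|[_]] := GQ _ GA; last exact.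
  by move: A0; rewrite A00 => -[].
have [F0|[fF NF]] := QF.
  exfalso; apply: (Fmax N); last by right; split.
  rewrite F0; split => // /(_ setT); apply.
  by split => //; exact: openT.
exists F; split; last by move=> U oU Ux; exact: NF.
split => // G fG FG; apply: contrapT => GF.
apply: (Fmax G); last by right; split => //; exact: subset_trans FG.
by split => // GF'; apply: GF; apply/seteqP.
Qed.

Lemma section_exists : exists b : X -> EX X, is_section b.
Proof.
pose F x := cid (open_ultrafilter_exists x).
have FP x : open_ultrafilter (sval (F x)) /\ open_converges (sval (F x)) x.
  exact: (svalP (F x)).
exists (fun x => exist _ (sval (F x)) (conj (FP x).1 (ex_intro _ x (FP x).2))).
by move=> x; exact: (FP x).2.
Qed.

Lemma aL'P :
  is_least_card (fun K => exists b : X -> EX X,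
    is_section b /\ [set: K] #= [set: aLb b]) (aL' X).
Proof.
by apply: leastP; have [b sb] := section_exists; exists (aLb b), b.
Qed.

Lemma aL'_attained :
  exists b : X -> EX X, is_section b /\ [set: aLb b] #= [set: aL' X].
Proof. by have [[b [sb e]] _] := aL'P; exists b; split => //; rewrite card_eq_sym. Qed.

End well_defined.

(* Main.v *)
Require Import Defs.
From mathcomp Require Import all_boot all_order.
From mathcomp Require Import boolp classical_sets functions cardinality.
From mathcomp Require Import topology.

Local Open Scope classical_set_scope.
Local Open Scope card_scope.

(** If [C] is [c_b]-closed, each [x] outside [C] has an open neighbourhood [U]
    with [hat b U] disjoint from [C]. Adding these neighbourhoods to a cover of
    [C] yields a cover of [X]; among few members whose hats cover [X], the added
    ones are useless on [C], and [hat b U] is contained in [closure U]. *)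

Lemma card_leT_injective (T U : Type) :
  [set: T] #<= [set: U] -> exists f : T -> U, injective f.
Proof.
move=> /card_leP[f]; exists (fun t => val (f (to_setT t))) => t u.
by move=> /val_inj /(@inj _ _ _ f) => /(_ (in_setT _) (in_setT _)) [].
Qed.

Lemma card_le_sum_nat (K : Type) :
  infinite_card K -> [set: (K + nat)%type] #<= [set: K].
Proof.
move=> /infiniteP /card_leT_injective[f f_inj].
(* Hilbert's hotel along the copy [f] of [nat] inside [K]. *)
pose g (s : K + nat) : K := match s with
  | inl k => if pselect (exists n, f n = k) is left h then f (sval (cid h)).*2
             else k
  | inr n => f n.*2.+1
  end.
apply: (@inj_cardT _ _ g) => -[k|m] [l|n] /=.
- case: pselect => [hk|nk]; case: pselect => [hl|nl].
  + move=> /f_inj /double_inj kl.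
    by rewrite -(svalP (cid hk)) -(svalP (cid hl)) kl.
  + by move=> kl; case: nl; exists (sval (cid hk)).*2.
  + by move=> kl; case: nk; exists (sval (cid hl)).*2.
  + by move=> ->.
(* Inside the range of [f] the two summands use indices of opposite parity; a point that [g] fixes
   lies outside that range. *)
- case: pselect => [hk /f_inj /(congr1 odd)|nk kn].
    by rewrite /= !odd_double.
  by case: nk; exists n.*2.+1.
- case: pselect => [hl /f_inj /(congr1 odd)|nl ml].
    by rewrite /= !odd_double.
  by case: nl; exists m.*2.+1.
- by move=> /f_inj [] /double_inj ->.
Qed.

(** Absorbs the summand [nat] in [aLb], so that only [sup_aL] has to be bounded. *)
Lemma card_leT_sum_nat (S K : Type) : infinite_card K ->
  [set: S] #<= [set: K] -> [set: (S + nat)%type] #<= [set: K].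
Proof.
move=> K_inf /card_leT_injective[f f_inj].
apply: card_le_trans (card_le_sum_nat K K_inf).
apply: (@inj_cardT _ _
  (fun s : S + nat => match s with inl t => inl (f t) | inr n => inr n end)).
by move=> [t|m] [u|n] //= [] => [/f_inj|] ->.
Qed.

Section section_invariants.
Context {X : topologicalType} (b : X -> EX X) (b_sec : is_section b).

(** By convergence every open neighbourhood of [x] belongs to the filter [b x]; it therefore meets
    each member [U] of that filter. *)
Lemma hat_sub_closure (U : set X) : hat b U `<=` closure U.
Proof.
move=> x Ux B; rewrite nbhsE => -[O [oO Ox] OB].
have [[bF _] _] := svalP (b x).
have [y [Uy Oy]] : U `&` O !=set0.
  by apply: (open_filter_mem_nonempty bF); apply: (open_filterI bF) => //;
    exact: b_sec.
by exists y; split => //; exact: OB.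
Qed.

Lemma aL_le_L' (C : set X) : cb_closed b C -> [set: aL C] #<= [set: L' b].
Proof.
move=> Ccl; have [[L'_inf L'_cov] _] := L'P b_sec.
apply: (aLP C).2; split => // V [oV CV].
pose N := [set U | open U /\ hat b U `&` C = set0].
have [|W [WVN WL' XW]] := L'_cov (V `|` N).
  split => [U [/oV//|[]//]|x _].
  have [/CV[U VU Ux]|] := pselect (C x); first by exists U => //; left.
  (* Since [C] equals [cb b C], a point outside [C] has a neighbourhood in [N]. *)
  rewrite -{1}Ccl => /existsNP[U /not_implyP[oU /not_implyP[Ux /nonemptyPn UC]]].
  by exists U => //; right.
(* A point of [C] lies in no [hat b U] with [U] in [N], so the members of [W] taken from [V] suffice
   on [C]. *)
exists (W `&` V); split; first by move=> U [].
  exact: card_le_trans (subset_card_le (@subIsetl _ _ _)) WL'.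
move=> x Cx; have [U WU Ux] : (\bigcup_(U in W) hat b U) x by rewrite -XW.
have [VU|[_ UC]] := WVN _ WU; first by exists U => //; exact: hat_sub_closure.
by have : (hat b U `&` C) x by []; rewrite UC.
Qed.

Lemma aLb_le_L' : [set: aLb b] #<= [set: L' b].
Proof.
have [[L'_inf _] _] := L'P b_sec.
by apply: card_leT_sum_nat => //; apply: (sup_aLP b).2; exact: aL_le_L'.
Qed.

(** An open [U] lies in [hat b U] by convergence, so the hats of a subcover also cover [X]. *)
Lemma L'_le_L : [set: L' b] #<= [set: L X].
Proof.
have [[L_inf L_cov] _] := @LP X.
apply: (L'P b_sec).2; split => // V VX; have [W [WV WL XW]] := L_cov V VX.
exists W; split => //; apply/seteqP; split => // x /XW[U WU Ux].
by exists U => //; exact: sub_hat b_sec (VX.1 _ (WV _ WU)) _ Ux.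
Qed.

End section_invariants.

Theorem corollary3p3 (X : topologicalType) (hX : hausdorff_space X)
    (b' : X -> EX X) (hb' : is_section b')
    (hmin : [set: aLb b'] #= [set: aL' X]) :
  [set: aL' X] #<= [set: L' b'] /\ [set: L' b'] #<= [set: L X].
Proof.
split; last exact: L'_le_L.
by rewrite -(card_le_eql hmin); exact: aLb_le_L'.
Qed.
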